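(* Let $\mathcal{H}$ be a separable complex Hilbert space and let $P_1, P_2 \in \mathcal{B}(\mathcal{H})$ be two projections. Then $$\text{SOT-}\lim_{m\to \infty} (P_1 P_2)^m = P_{\mathcal{H}_u},$$ where $\mathcal{H}_u$ is the unitary part of the canonical decomposition of the contraction $P_1 P_2$.
   Context: A projection is an orthogonal projection: $P \in \mathcal{B}(\mathcal{H})$ with $P = P^* = P^2$. $P_{\mathcal{S}}$ denotes the orthogonal projection onto a closed subspace $\mathcal{S}$, and SOT is the strong operator topology. For a contraction $T \in \mathcal{B}(\mathcal{H})$, the canonical (Nagy-Foias and Langer) decomposition is the unique orthogonal decomposition $\mathcal{H} = \mathcal{H}_u \oplus \mathcal{H}_{cnu}$ such that both summands reduce $T$, $T|_{\mathcal{H}_u}$ is unitary, and $T|_{\mathcal{H}_{cnu}}$ is completely non-unitary (it has no nontrivial unitary summand). The unitary part is $\mathcal{H}_u = \{h \in \mathcal{H}: \|T^m h\| = \|T^{*m} h\| = \|h\| \text{ for all } m \in \mathbb{N}\}$. *)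

(* Defs.v *)
From HB Require Import structures.
From mathcomp Require Import all_boot all_order all_algebra.
From mathcomp Require Import sesquilinear.
From mathcomp Require Import complex.
From mathcomp Require Import all_classical all_reals all_analysis.

Set Implicit Arguments.
Unset Strict Implicit.
Unset Printing Implicit Defensive.

Import Order.TTheory GRing.Theory Num.Theory.
Import numFieldNormedType.Exports.

Local Open Scope classical_set_scope.
Local Open Scope complex_scope.
Local Open Scope ring_scope.

Definition separable (T : topologicalType) : Prop :=
  exists2 D : set T, countable D & dense D.

(* A complex Hilbert space is a Banach space H over R[i] with a positive
   definite Hermitian form dot (linear on the left, conjugate-linear on the
   right) whose induced norm is the norm of H. *)
Definition norm_from_dot (R : realType) (H : completeNormedModType R[i])
    (dot : {dot H for Num.conj}) : Prop :=
  forall h : H, dot h h = `|h| ^+ 2.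

Section Operators.
Variables (R : realType) (H : completeNormedModType R[i]).
Variable dot : {dot H for Num.conj}.
Implicit Types (S T P Q : H -> H).

Definition is_adjoint T S : Prop := forall x y, dot (T x) y = dot x (S y).

(* A total function: it is T^* whenever T has an adjoint (see [adjointE]);
   every bounded operator on a Hilbert space has one. *)
Definition adjoint T : H -> H := get [set S | is_adjoint T S].

(* For linear maps, continuous means bounded; [is_adjoint P P] is P = P^*. *)
Definition is_projection P : Prop :=
  [/\ linear P, continuous P, is_adjoint P P & P \o P = P].

(* A total function of the set M: it is the projection with range M whenever
   there is one (see [proj_ontoE]), i.e. whenever M is a closed subspace. *)
Definition proj_onto (M : set H) : H -> H :=
  get [set P | is_projection P /\ range P = M].

Definition unitary_part T : set H :=
  [set h | forall m : nat,
     `|iter m T h| = `|h| /\ `|iter m (adjoint T) h| = `|h|].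

Definition sot_cvg (T_ : nat -> H -> H) T : Prop :=
  forall h, T_ m h @[m --> \oo] --> T h.

Lemma dot_inj (x y : H) : (forall z, dot z x = dot z y) -> x = y.
Proof.
move=> xy; apply/eqP; rewrite -subr_eq0; apply/eqP.
apply: contrapT => /eqP /(@neq0_dnorm_gt0 _ _ _ dot).
by rewrite linearBr /= !xy subrr ltxx.
Qed.

Lemma adjointE T S : is_adjoint T S -> adjoint T = S.
Proof.
move=> TS; apply: get_unique => // S' TS'.
by apply/funext => y; apply: dot_inj => z; rewrite -TS -TS'.
Qed.

Lemma adjoint_comp S S' T T' :
  is_adjoint S S' -> is_adjoint T T' -> is_adjoint (S \o T) (T' \o S').
Proof. by move=> SS' TT' x y /=; rewrite SS' TT'. Qed.

Lemma proj_ontoE (M : set H) P :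
  is_projection P -> range P = M -> proj_onto M = P.
Proof.
move=> pP rP; apply: get_unique => // Q [pQ rQ].
have fixr (A B : H -> H) : is_projection B -> range A = range B -> B \o A = A.
  move=> [_ _ _ BB] AB; apply/funext => x /=.
  have : range B (A x) by rewrite -AB; exists x.
  by move=> [y _ <-]; rewrite -[LHS]/((B \o B) y) BB.
have QP := fixr P Q pQ (etrans rP (esym rQ)).
have PQ := fixr Q P pP (etrans rQ (esym rP)).
move: pP pQ => [_ _ aP _] [_ _ aQ _].
apply/funext => y; apply: dot_inj => z.
have -> : dot z (Q y) = dot z (Q (P y)).
  by rewrite -!aQ -aP -[P (Q z)]/((P \o Q) z) PQ.
by rewrite -[Q (P y)]/((Q \o P) y) QP.
Qed.

End Operators.

(* Main.v *)
Require Import Defs.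
From mathcomp Require Import all_boot all_order all_algebra.
From mathcomp Require Import sesquilinear.
From mathcomp Require Import complex.
From mathcomp Require Import ring.
From mathcomp Require Import all_classical all_reals all_analysis.

Import numFieldNormedType.Exports.
Local Open Scope complex_scope.
Local Open Scope ring_scope.

(** Put T = P1 P2 and Q = P1 P2 P1. The operator Q is self-adjoint and
    T^(m+1) = Q^m T, so the powers of T converge strongly as soon as those of
    Q do. For the latter, b_n = <Q^n x, x> is a nonincreasing sequence of
    nonnegative numbers: two projections satisfy |Q y|^2 <= <Q y, y>, which
    gives one half of the steps, and implies <Q y, y> <= |y|^2, which gives
    the other half. Since <Q^m x, Q^n x> = b_(m+n), the distance
    |Q^m x - Q^n x|^2 = b_(2m) - 2 b_(m+n) + b_(2n) is small because b
    converges: the powers are Cauchy ([selfadjoint_iter_cvg]).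

    The strong limit E of the powers of the contraction T is the orthogonal
    projection onto the fixed vectors of T ([sot_lim_projection]), because
    T^* fixes these as well.

    Finally the fixed vectors of T are exactly its unitary part
    ([unitary_part_fix]): a projection that preserves the norm of a vector
    fixes it, so |P1 P2 h| = |h| forces P2 h = h and then P1 h = h. Hence the
    unitary part is the intersection of the ranges of P1 and P2. *)

Set Implicit Arguments.
Unset Strict Implicit.
Unset Printing Implicit Defensive.

Import Order.TTheory GRing.Theory Num.Theory.

Local Open Scope classical_set_scope.

(** The squared length of <v, v> u - <u, v> v is <v, v> times the difference
    of the two sides. *)
Lemma dot_cauchy_schwarz (C : numClosedFieldType) (U : lmodType C)
    (dot : {dot U for Num.conj}) (u v : U) :
  `|dot u v| ^+ 2 <= dot u u * dot v v.
Proof.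
have [->|v0] := eqVneq v 0; first by rewrite !linear0r normr0 expr0n.
have vv_gt0 : 0 < dot v v by exact: neq0_dnorm_gt0.
have vv_real : (dot v v)^* = dot v v by exact/CrealP/gtr0_real.
have dotZZ a b : dot (a *: u) (b *: v) = a * (b^* * dot u v).
  by rewrite (linearZl_LR dot) /= (linearZr_LR dot).
have := dnorm_ge0 dot (dot v v *: u - dot u v *: v).
rewrite dnormB !dnormZ dotZZ !rmorphM /= conjCK vv_real.
rewrite (ger0_norm (ltW vv_gt0)) normCK => h.
rewrite -(ler_pM2l vv_gt0) -subr_ge0; apply: le_trans h _.
by rewrite le_eqVlt; apply/orP; left; apply/eqP; ring.
Qed.

(** A bounded monotone sequence is Cauchy. The values are complex numbers that
    happen to be real, so the infimum is taken over their real parts. Only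
    [m] has to be large: b_n is never below the infimum. *)
Lemma nonincreasing_ge0_gap (R : realType) (b : nat -> R[i]) :
    (forall n, 0 <= b n) -> nonincreasing_seq b ->
  forall e, 0 < e ->
  exists N, forall m n, (N <= m)%N -> b m - b n < e.
Proof.
move=> b_ge0 b_anti e e0.
have bE n : (complex.Re (b n))%:C = b n by exact/RRe_real/ger0_real.
have eE : (complex.Re e)%:C = e by exact/RRe_real/gtr0_real.
have re0 : 0 < complex.Re e by rewrite -ltcR eE.
pose A := range (fun n => complex.Re (b n)).
have A_lb : lbound A 0 by move=> _ [n _ <-]; rewrite -lecR bE.
have hA : has_inf A by split; [exists (complex.Re (b 0%N)), 0%N | exists 0].
have [_ [N _ <-] hN] := inf_adherent re0 hA.
exists N => m n Nm; rewrite ltrBlDl -bE -[b n]bE -eE -rmorphD /= ltcR.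
have bmN : complex.Re (b m) <= complex.Re (b N) by rewrite -lecR !bE b_anti.
apply: le_lt_trans bmN (lt_le_trans hN _); rewrite lerD2r.
by apply: ge_inf; [case: hA | exists n].
Qed.

Section Hilbert.
Variables (R : realType) (H : completeNormedModType R[i]).
Variable dot : {dot H for Num.conj}.
Hypothesis hdot : norm_from_dot dot.
Implicit Types (S T P Q : H -> H).

Lemma dotC x y : dot x y = (dot y x)^*.
Proof. by rewrite hermC mul1r. Qed.

Lemma iter_adjoint T S (m : nat) :
  is_adjoint dot T S -> is_adjoint dot (iter m T) (iter m S).
Proof. by move=> TS; elim: m => // m IH x y; rewrite iterS TS IH -iterSr. Qed.

(** The hypothesis |Q y|^2 <= <Q y, y> says that Q^2 <= Q as forms, which for
    a self-adjoint Q amounts to 0 <= Q <= 1. *)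
Lemma selfadjoint_iter_cvg Q : is_adjoint dot Q Q ->
    (forall y, dot (Q y) (Q y) <= dot (Q y) y) ->
  forall x, cvgn (fun n => iter n Q x).
Proof.
move=> QQ Qfirm x; apply/cauchy_cvgP/cauchy_exP => e e0.
(* The other bound Q <= 1 follows: 0 <= |y - Q y|^2. *)
have Qcontr y : dot (Q y) y <= dot y y.
  have := dnorm_ge0 dot (y - Q y).
  rewrite linearBl /= !linearBr /= -[dot y (Q y)]QQ subr_ge0 => h.
  by rewrite -subr_ge0 (le_trans _ h)// subr_ge0.
pose b n := dot (iter n Q x) x.
have bD m n : dot (iter m Q x) (iter n Q x) = b (m + n)%N.
  by rewrite addnC /b iterD (iter_adjoint n QQ).
have hb n : 0 <= b n.+1 <= b n.
  (* Even and odd steps are Q <= 1 and Q^2 <= Q at the vector Q^(n/2) x. *)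
  rewrite -[n]odd_double_half; set k := n./2; set y := iter k Q x.
  have b0 : b k.*2 = dot y y by rewrite -addnn -bD.
  have b1 : b k.*2.+1 = dot (Q y) y by rewrite -addnn -addSn -bD.
  have b2 : b k.*2.+2 = dot (Q y) (Q y).
    by rewrite -addnn -addSn -addnS -bD.
  case: (odd n); rewrite ?add0n ?add1n ?b0 ?b1 ?b2.
    by rewrite dnorm_ge0 Qfirm.
  by rewrite (le_trans (dnorm_ge0 dot (Q y)) (Qfirm y)) Qcontr.
have b_ge0 n : 0 <= b n.
  by case: n => [|n]; [exact: dnorm_ge0 | have /andP[] := hb n].
have b_anti : nonincreasing_seq b.
  by apply/nonincreasing_seqP => n; have /andP[] := hb n.
have [N hN] := nonincreasing_ge0_gap b_ge0 b_anti (exprn_gt0 2 e0).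
exists (iter N Q x); exists N => // n /= Nn.
rewrite -ball_normE /= -(ltr_pXn2r (n := 2)) ?nnegrE ?(ltW e0)//.
rewrite -hdot linearBl /= !linearBr /= !bD [(n + N)%N]addnC.
(* |Q^N x - Q^n x|^2 = (b_(2N) - b_(N+n)) - (b_(N+n) - b_(2n)), and the
   second difference is nonnegative. *)
apply: le_lt_trans (hN (N + N)%N (N + n)%N (leq_addr _ _)).
rewrite opprB gerDl subr_le0.
by rewrite b_anti// leq_add2r.
Qed.

Lemma dot_cvg (u : nat -> H) (l z : H) :
  u n @[n --> \oo] --> l -> dot (u n) z @[n --> \oo] --> dot l z.
Proof.
move=> /cvgrPdist_lt ul; apply/cvgrPdist_lt => e e0.
(* The summand 1 avoids a division by zero when z = 0. *)
have z1 : 0 < `|z| + 1 by rewrite ltr_wpDl.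
have [N _ hN] := ul _ (divr_gt0 e0 z1); exists N => // n /= Nn.
have := hN n Nn; rewrite /= ltr_pdivlMr// => /(le_lt_trans _); apply.
rewrite -linearBl /=; apply: le_trans (ler_wpM2l _ (_ : `|z| <= _)) => //.
  rewrite -(ler_pXn2r (n := 2)) ?nnegrE ?mulr_ge0// exprMn -!hdot.
  exact: dot_cauchy_schwarz.
by rewrite lerDl.
Qed.

(** If the powers of a contraction T converge strongly, the limit is a
    contraction which fixes the fixed vectors of T and takes its values there.
    It is self-adjoint, hence the orthogonal projection onto these vectors,
    because <T^n x, E y> = <x, T^*^n E y> does not depend on n once T^* fixes
    E y: in the limit, <E x, E y> = <x, E y>. *)
Lemma sot_lim_projection T S E : linear T -> continuous T ->
    (forall x, `|T x| <= `|x|) ->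
    is_adjoint dot T S -> (forall z, T z = z -> S z = z) ->
    sot_cvg (fun m => iter m T) E ->
  is_projection dot E /\ range E = [set z | T z = z].
Proof.
move=> Tlin Tcont Tcontr TS fixS TE.
have uniq_lim (u : nat -> H) (a b : H) : u n @[n --> \oo] --> a ->
    u n @[n --> \oo] --> b -> a = b.
  exact: norm_cvg_unique.
have TEfix x : T (E x) = E x.
  apply: (uniq_lim (fun n => iter n.+1 T x)).
    exact: (continuous_cvg _ (Tcont (E x)) (TE x)).
  by have := TE x; rewrite -cvg_shiftS.
have fixE z : T z = z -> E z = z.
  move=> Tz; apply: (uniq_lim (fun n => iter n T z)); first exact: TE.
  have -> : (fun n => iter n T z) = fun=> z by apply/funext => n; rewrite iter_fix.
  exact: cvg_cst.
have Elin : linear E.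
  move=> a x y; apply: (uniq_lim (fun n => iter n T (a *: x + y))).
    exact: TE.
  have -> : (fun n => iter n T (a *: x + y)) =
            (fun n => a *: iter n T x + iter n T y).
    by apply/funext; elim=> // n IH; rewrite iterS IH Tlin.
  by apply: cvgD; [apply: cvgZl_tmp; exact: TE|exact: TE].
have Econtr x : `|E x| <= `|x|.
  apply/ler_addgt0Pr => e e0.
  have /cvgrPdist_lt /(_ e e0) [N _ hN] := TE x.
  rewrite -[E x](subrK (iter N T x)) addrC.
  apply: le_trans (ler_normD _ _) (lerD _ (ltW (hN N (leqnn N)))).
  by elim: N {hN} => // N IH; rewrite iterS (le_trans (Tcontr _)).
have EB x y : E x - E y = E (x - y).
  by rewrite addrC -(scaleN1r (E y)) -Elin scaleN1r addrC.
have Econt : continuous E.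
  move=> x; apply/cvgrPdist_lt => e e0.
  apply: filterS (nbhsx_ballx x e e0) => y /=.
  rewrite -ball_normE /= EB; exact: le_lt_trans (Econtr _).
have Eorth x y : dot (E x) (E y) = dot x (E y).
  have TnE n : dot (iter n T x) (E y) = dot x (E y).
    by rewrite (iter_adjoint n TS) iter_fix ?fixS.
  have := dot_cvg (z := E y) (TE x).
  rewrite (_ : (fun n => dot _ _) = fun=> dot x (E y)); last exact/funext.
  by move=> h; apply: norm_cvg_unique h (cvg_cst _).
split; first split => //.
- by move=> x y; rewrite -(Eorth x) [RHS]dotC Eorth -dotC.
- by apply/funext => x /=; rewrite fixE.
- apply/seteqP; split=> [_ [x _ <-] /=|z /= Tz]; first exact: TEfix.
  by exists z => //; exact: fixE.
Qed.

Section ProjectionLemmas.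
Variable P : H -> H.
Hypothesis hP : is_projection dot P.

Lemma projK x : P (P x) = P x.
Proof. by case: hP => _ _ _ PP; rewrite -[LHS]/((P \o P) x) PP. Qed.

Lemma dot_proj x : dot (P x) x = dot (P x) (P x).
Proof. by case: hP => _ _ PP _; rewrite -[in LHS]projK PP. Qed.

Lemma proj_pythagoras x : `|x| ^+ 2 = `|P x| ^+ 2 + `|x - P x| ^+ 2.
Proof.
case: hP => _ _ PP _.
rewrite -!hdot linearBl /= !linearBr /= -[dot x (P x)]PP dot_proj.
by rewrite subrr subr0 addrC subrK.
Qed.

Lemma proj_norm_le x : `|P x| <= `|x|.
Proof.
rewrite -(ler_pXn2r (n := 2)) ?nnegrE// [leRHS]proj_pythagoras lerDl.
exact: exprn_ge0.
Qed.

Lemma proj_norm_fix x : `|P x| = `|x| -> P x = x.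
Proof.
move=> Px; have := proj_pythagoras x; rewrite Px => /eqP.
rewrite -subr_eq0 opprD addrA subrr sub0r oppr_eq0 expf_eq0 /= normr_eq0.
by rewrite subr_eq0 => /eqP.
Qed.

End ProjectionLemmas.

Section TwoProjections.
Variables P1 P2 : H -> H.
Hypotheses (hP1 : is_projection dot P1) (hP2 : is_projection dot P2).

(** In |P1 (P2 z)| <= |P2 z| <= |z| equality must hold twice, and a projection
    fixes the vectors whose norm it preserves. *)
Lemma comp_proj_fix z : `|P1 (P2 z)| = `|z| -> P1 z = z /\ P2 z = z.
Proof.
move=> h.
have P2z : P2 z = z.
  apply: (proj_norm_fix hP2); apply/eqP; rewrite eq_le proj_norm_le//=.
  by rewrite -h proj_norm_le.
by split=> //; apply: (proj_norm_fix hP1); rewrite -[in LHS]P2z.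
Qed.

Lemma adjoint_comp_proj : is_adjoint dot (P1 \o P2) (P2 \o P1).
Proof. by case: hP1 hP2 => _ _ a1 _ [_ _ a2 _]; exact: adjoint_comp. Qed.

(** The condition of the unitary part for the first power of T alone already
    puts a vector in the ranges of both projections. *)
Lemma unitary_part_fix :
  unitary_part dot (P1 \o P2) = [set z | (P1 \o P2) z = z].
Proof.
rewrite /unitary_part (adjointE adjoint_comp_proj).
apply/seteqP; split=> z /=.
  move=> /(_ 1%N)[/= h _]; have [P1z P2z] := comp_proj_fix h.
  by rewrite P2z.
move=> Tz; have [P1z P2z] : P1 z = z /\ P2 z = z.
  by apply: comp_proj_fix; rewrite Tz.
by move=> m; rewrite !iter_fix//= P1z.
Qed.

(** P1 P2 is not self-adjoint, but its powers are those of P1 P2 P1 applied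
    to P1 P2 x. *)
Lemma iter_comp_proj_cvg x : cvgn (fun n => iter n (P1 \o P2) x).
Proof.
case: hP1 hP2 => _ _ a1 _ [_ _ a2 _].
pose Q := P1 \o P2 \o P1.
have QQ : is_adjoint dot Q Q by move=> y z; rewrite /Q /= a1 a2 a1.
have Qfirm y : dot (Q y) (Q y) <= dot (Q y) y.
  rewrite [leRHS]a1 (dot_proj hP2) !hdot ler_pXn2r ?nnegrE//.
  exact: (proj_norm_le hP1 (P2 (P1 y))).
have TQ n : iter n.+1 (P1 \o P2) x = iter n Q ((P1 \o P2) x).
  elim: n => // n IH; rewrite iterS IH [RHS]iterS.
  suff P1Q : P1 (iter n Q ((P1 \o P2) x)) = iter n Q ((P1 \o P2) x).
    by rewrite /Q /= P1Q.
  by case: n {IH} => [|n]; rewrite ?iterS /= projK.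
have /(_ ((P1 \o P2) x)) /cvg_ex[l hl] := @selfadjoint_iter_cvg Q QQ Qfirm.
apply/cvg_ex; exists l; rewrite -cvg_shiftS.
by rewrite (_ : [sequence _]_n = fun n => iter n Q ((P1 \o P2) x)) //; exact/funext.
Qed.

End TwoProjections.
End Hilbert.

Theorem theorem4p1 (R : realType) (H : completeNormedModType R[i])
  (dot : {dot H for Num.conj}) (hdot : norm_from_dot dot)
  (hsep : separable H)
  (P1 P2 : H -> H) (hP1 : is_projection dot P1) (hP2 : is_projection dot P2) :
  sot_cvg (fun m : nat => iter m (P1 \o P2))
          (proj_onto dot (unitary_part dot (P1 \o P2))).
Proof.
pose T := P1 \o P2; pose E x := limn (fun n => iter n T x).
have TE : sot_cvg (fun m => iter m T) E by move=> x; exact: iter_comp_proj_cvg.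
have [E_proj rE] : is_projection dot E /\ range E = [set z | T z = z].
  case: (hP1) (hP2) => l1 c1 _ _ [l2 c2 _ _].
  apply: (sot_lim_projection hdot _ _ _ (adjoint_comp_proj hP1 hP2)) TE.
  - by move=> a x y; rewrite /T /= l2 l1.
  - by move=> x; apply: continuous_comp; [exact: c2|exact: c1].
  - by move=> x; apply: le_trans (proj_norm_le hdot hP1 _) (proj_norm_le hdot hP2 _).
  - move=> z Tz; have [P1z P2z] := comp_proj_fix hdot hP1 hP2 (congr1 Num.norm Tz).
    by rewrite /= P1z.
by rewrite (unitary_part_fix hdot hP1 hP2) (proj_ontoE E_proj rE).
Qed.
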